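(* Let $v\in\mathbb{R}^{n\times m}_+$ be nondegenerate and $B\in\mathbb{R}^n_{>0}$. Let $\mathcal{X}=\{x\in\mathbb{R}^{n\times m}_+:\sum_ix_{ij}=1\ \forall j\}$ and $A:\mathbb{R}^{n\times m}\to\mathbb{R}^n$, $Ax=(\langle v_1,x_1\rangle,\dots,\langle v_n,x_n\rangle)$, so $\|A\|=\max_i\|v_i\|_2$. Let $\underline u_i=\frac{B_i\|v_i\|_1}{\|B\|_1}$ and define $\tilde h(u)=\sum_i\tilde h_i(u_i)$ with $\tilde h_i(u_i)=-B_i\log u_i$ for $u_i>\underline u_i$ and $\tilde h_i(u_i)=\frac{B_i}{2\underline u_i^2}(u_i-\underline u_i)^2-\frac{B_i}{\underline u_i}(u_i-\underline u_i)-B_i\log\underline u_i$ for $u_i\le\underline u_i$. Let $\mu=\min_i\frac{B_i}{\|v_i\|_1^2}$, $L=\max_i\frac{B_i}{\underline u_i^2}$, $F(x)=\tilde h(Ax)$ and $F^*=\min_{x\in\mathcal{X}}F$. Then projected gradient $x^{t+1}=\Pi_{\mathcal{X}}(x^t-\frac{1}{L\|A\|^2}\nabla F(x^t))$ started at $x^0\in\mathcal{X}$ satisfies $$F(x^t)-F^*\le\left(1-\frac{\mu}{\max\{\mu,\,LH_{\mathcal{X}}(A)^2\|A\|^2\}}\right)^t(F(x^0)-F^* )\quad\forall t\ge0.$$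
   Context: $v_i$ is the $i$-th row of $v$; nondegenerate means no zero row or column. $x_i$ is the $i$-th row of $x$; $\mathcal{X}$ is viewed as a subset of $\mathbb{R}^{nm}$. $\Pi_{\mathcal{X}}$ is Euclidean projection. Hoffman constant: $H_{\mathcal{X}}(A)$ is the smallest $H>0$ such that for every $z$ with $\mathcal{X}\cap\{x:Ax=z\}\neq\emptyset$, setting $\mathcal{S}=\{x:Ax=z\}$, $\|x-\Pi_{\mathcal{X}\cap\mathcal{S}}(x)\|\le H\|Ax-z\|$ for all $x\in\mathcal{X}$. *)

(* Defs.v *)
From mathcomp Require Import all_boot all_order all_algebra.
From mathcomp Require Import all_classical all_reals all_analysis.
Set Implicit Arguments. Unset Strict Implicit. Unset Printing Implicit Defensive.
Import Order.TTheory GRing.Theory Num.Theory.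
Local Open Scope classical_set_scope.
Local Open Scope ring_scope.

Section Defs.
Variables (R : realType) (n m : nat).
Implicit Types (v x y : 'M[R]_(n, m)) (u z B : 'I_n -> R).

Definition fro_norm x : R := Num.sqrt (\sum_i \sum_j x i j ^+ 2).
Definition vec_norm u : R := Num.sqrt (\sum_i u i ^+ 2).

Definition nonneg_mx v := forall i j, 0 <= v i j.
Definition nondegen_mx v :=
  (forall i : 'I_n, exists j, v i j != 0) /\ (forall j : 'I_m, exists i, v i j != 0).

Definition Xset : set 'M[R]_(n, m) :=
  [set x | (forall i j, 0 <= x i j) /\ (forall j, \sum_i x i j = 1)].

Definition Aop v x : 'I_n -> R := fun i => \sum_j v i j * x i j.

Definition normA v : R := \big[Num.max/0]_i Num.sqrt (\sum_j v i j ^+ 2).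

Definition norm1_row v (i : 'I_n) : R := \sum_j `|v i j|.
Definition norm1 B : R := \sum_i `|B i|.

Definition is_proj (S : set 'M[R]_(n, m)) y p :=
  S p /\ forall q, S q -> fro_norm (y - p) <= fro_norm (y - q).

Definition hoffman_ok v (H : R) :=
  forall z, (exists x, Xset x /\ Aop v x = z) ->
  forall x p, Xset x -> is_proj (Xset `&` [set y | Aop v y = z]) x p ->
    fro_norm (x - p) <= H * vec_norm (fun i => Aop v x i - z i).
Definition hoffman v : R := inf [set H | 0 < H /\ hoffman_ok v H].

Definition ulow v B (i : 'I_n) : R := B i * norm1_row v i / norm1 B.

Definition htilde_i v B (i : 'I_n) (s : R) : R :=
  let a := ulow v B i in
  if a < s then - (B i * ln s)
  else B i / (2 * a ^+ 2) * (s - a) ^+ 2 - B i / a * (s - a) - B i * ln a.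

Definition htilde v B u : R := \sum_i htilde_i v B i (u i).

Definition Fobj v B x : R := htilde v B (Aop v x).
Definition Fstar v B : R := inf [set Fobj v B x | x in Xset].

Definition mu_c v B : R := \big[Num.min/(\big[Num.max/0]_i (B i / norm1_row v i ^+ 2))]_i
                              (B i / norm1_row v i ^+ 2).
Definition L_c v B : R := \big[Num.max/0]_i (B i / ulow v B i ^+ 2).

Definition grad (F : 'M[R]_(n, m) -> R) x : 'M[R]_(n, m) :=
  \matrix_(i, j) derive1 (fun s : R => F (x + s *: delta_mx i j)) 0.

End Defs.

(* Main.v *)
(* Finiteness of the Hoffman constant. For a fixed sign pattern of [d], if the
   cone of matrices with that pattern and zero column sums meets [ker A] only
   at [0], then [|d| <= K |A d|] on the cone by compactness of its unit sphere.
   Otherwise, subtracting from [d] a suitable multiple of a kernel element of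
   the cone shrinks every entry of [d] towards [0], kills one of them and keeps
   [A d]; iterating reaches the first case. Applied to [d = y - x] with [x, y]
   in [X], the result [e] gives [x + e] in [X] with [A (x + e) = A y]. There are
   finitely many patterns, so one [K] serves them all.

   Rate. Each penalty is C^1, and monotonicity of [h' - mu id] on
   [u <= |v_i|_1] and of [L id - h'] gives the two quadratic bounds. For every
   [y] in [X] (not only a minimiser), with [q] the projection of [x^t] onto
   [X] intersected with [A = A y], minimality of [x^(t+1)] against
   [x^t + c (q - x^t)] yields [F x^(t+1) - F y <= (1 - c) (F x^t - F y)]; the
   infimum over [y] is taken at the end, so existence of a minimiser of [F] is
   never needed. *)
Require Import Defs.
From mathcomp Require Import all_boot all_order all_algebra.
From mathcomp Require Import all_classical all_reals all_analysis.
From mathcomp Require Import lra ring.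
Import Order.TTheory GRing.Theory Num.Theory.
Import numFieldNormedType.Exports.
Local Open Scope classical_set_scope.
Local Open Scope ring_scope.

(** * Compact sets of matrices and attained minima *)

Section MatrixCompactness.
Variables (R : realType) (n m : nat).

Lemma continuous_bigsum (T : topologicalType) (V : normedModType R)
    (I : Type) (r : seq I) (F : I -> T -> V) :
  (forall i, continuous (F i)) -> continuous (fun x => \sum_(i <- r) F i x).
Proof.
move=> Fc; elim: r => [|i r IH] x.
  rewrite (_ : (fun _ => _) = fun=> 0); first exact: cvg_cst.
  by apply: funext => y; rewrite big_nil.
rewrite (_ : (fun _ => _) = fun y => F i y + \sum_(k <- r) F k y).
  by apply: cvgD; [exact: Fc|exact: IH].
by apply: funext => y; rewrite big_cons.
Qed.

Lemma continuous_vec_mx : continuous (@vec_mx R n m).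
Proof.
have -> : @vec_mx R n m =
    (fun u => \sum_i \sum_j (u 0 (mxvec_index i j)) *: delta_mx i j).
  apply: funext => u; rewrite [LHS]matrix_sum_delta.
  by apply: eq_bigr => i _; apply: eq_bigr => j _; rewrite mxE.
apply: continuous_bigsum => i; apply: continuous_bigsum => j x.
by apply: cvgZr_tmp; [exact: (@nbhs_filter _ x)|exact: (@coord_continuous R)].
Qed.

(** Boxes of row vectors are compact, and [vec_mx] maps such a box continuously onto the box of
    matrices. *)
Lemma mx_box_compact (b : R) :
  compact [set x : 'M[R]_(n, m) | forall i j, `|x i j| <= b].
Proof.
have cB : compact [set u : 'rV[R]_(n * m) | forall k, (`[- b, b]%classic : set R) (u ord0 k)].
  by apply: (@rV_compact R (n * m) (fun=> `[- b, b]%classic)) => k; exact: segment_compact.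
have := continuous_compact (continuous_subspaceT continuous_vec_mx) cB.
congr compact; apply/seteqP; split => [_ [u uB <-] i j|x xB].
  by rewrite mxE ler_norml; have := uB (mxvec_index i j); rewrite /= in_itv.
exists (mxvec x); last exact: mxvecK.
move=> k; case/mxvec_indexP: k => i j.
by rewrite mxvecE /= in_itv /= -ler_norml.
Qed.

Lemma bounded_closed_mx_min (S : set 'M[R]_(n, m)) (b : R) (f : 'M[R]_(n, m) -> R) :
  S !=set0 -> closed S -> (forall x, S x -> forall i j, `|x i j| <= b) ->
  continuous f -> exists2 c, S c & forall x, S x -> f c <= f x.
Proof.
move=> S0 Scl Sb fc.
have Sco : compact S by apply: (subclosed_compact Scl (mx_box_compact b)).
have [c /set_mem Sc cmin] := compact_EVT_min S0 Sco (continuous_subspaceT fc).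
by exists c => // x Sx; apply: cmin; exact/mem_set.
Qed.

Lemma closed_level (T : topologicalType) (f : T -> R) (c : R) :
  continuous f -> closed [set x | f x = c].
Proof. by move=> fc; exact: (preimage_closed (fun x _ => fc x) (@closed_eq _ _)). Qed.

Lemma closed_superlevel (T : topologicalType) (f : T -> R) (c : R) :
  continuous f -> closed [set x | c <= f x].
Proof. by move=> fc; exact: (preimage_closed (fun x _ => fc x) (@closed_ge _ _)). Qed.

End MatrixCompactness.

(** * Sign patterns and small corrections with a prescribed image under [Aop v] *)

Section Hoffman.
Context {R : realType} {n m : nat}.
Variable v : 'M[R]_(n, m).
Implicit Types (x y d e k : 'M[R]_(n, m)) (s : {ffun 'I_n * 'I_m -> option bool}).

Definition colsum0 d := forall j, \sum_i d i j = 0.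
Definition norm1_mx d : R := \sum_i \sum_j `|d i j|.
Definition norm1_Aop d : R := \sum_i `|Aop v d i|.

(** The inequalities are weak so that the cone is closed; patterns live in a finite type so that
    their constants can be summed. *)
Definition conformal s d := forall i j,
  match s (i, j) return Prop with
  | None => d i j = 0
  | Some b => 0 <= (if b then d i j else - d i j)
  end.

Definition sign_pattern d : {ffun 'I_n * 'I_m -> option bool} :=
  [ffun p => if d p.1 p.2 == 0 then None else Some (0 < d p.1 p.2)].

Lemma AopD x y i : Aop v (x + y) i = Aop v x i + Aop v y i.
Proof. by rewrite /Aop -big_split; apply: eq_bigr => j _; rewrite mxE mulrDr. Qed.

Lemma AopZ (c : R) x i : Aop v (c *: x) i = c * Aop v x i.
Proof. by rewrite /Aop mulr_sumr; apply: eq_bigr => j _; rewrite mxE mulrCA. Qed.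

Lemma AopB x y i : Aop v (x - y) i = Aop v x i - Aop v y i.
Proof. by rewrite -scaleN1r AopD AopZ mulN1r. Qed.

Lemma colsum0B d e : colsum0 d -> colsum0 e -> colsum0 (d - e).
Proof.
move=> d0 e0 j; under eq_bigr do rewrite !mxE.
by rewrite sumrB d0 e0 subrr.
Qed.

Lemma colsum0Z (c : R) d : colsum0 d -> colsum0 (c *: d).
Proof.
by move=> d0 j; under eq_bigr do rewrite mxE; rewrite -mulr_sumr d0 mulr0.
Qed.

Lemma norm1_mx_ge0 d : 0 <= norm1_mx d.
Proof. by apply: sumr_ge0 => i _; exact: sumr_ge0. Qed.

Lemma norm1_Aop_ge0 d : 0 <= norm1_Aop d.
Proof. exact: sumr_ge0. Qed.

Lemma norm1_mxZ (c : R) d : norm1_mx (c *: d) = `|c| * norm1_mx d.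
Proof.
rewrite /norm1_mx mulr_sumr; apply: eq_bigr => i _.
by rewrite mulr_sumr; apply: eq_bigr => j _; rewrite mxE normrM.
Qed.

Lemma norm1_AopZ (c : R) d : norm1_Aop (c *: d) = `|c| * norm1_Aop d.
Proof. by rewrite /norm1_Aop mulr_sumr; apply: eq_bigr => i _; rewrite AopZ normrM. Qed.

Lemma norm1_mx_entry d i j : `|d i j| <= norm1_mx d.
Proof.
rewrite /norm1_mx (bigD1 i) //= (bigD1 j) //= -addrA lerDl addr_ge0 //.
  by apply: sumr_ge0.
by apply: sumr_ge0 => ? _; apply: sumr_ge0.
Qed.

Lemma conformalZ (c : R) s d : 0 <= c -> conformal s d -> conformal s (c *: d).
Proof.
move=> c0 sd i j; have := sd i j; rewrite mxE.
by case: (s _) => [[]|->]; rewrite ?mulr0 // => h; rewrite -?mulrN mulr_ge0.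
Qed.

Lemma conformal_sign_pattern d : conformal (sign_pattern d) d.
Proof.
move=> i j; rewrite ffunE /=; case: eqP => // /eqP d0.
by case: ltP => [/ltW//|]; rewrite oppr_ge0.
Qed.

Lemma continuous_entry_sum (F : 'I_n -> 'I_m -> R -> R) :
  (forall i j, continuous (F i j)) ->
  continuous (fun x => \sum_i \sum_j F i j (x i j)).
Proof.
move=> Fc; apply: continuous_bigsum => i; apply: continuous_bigsum => j x.
by apply: continuous_comp; [exact: (@coord_continuous R)|exact: Fc].
Qed.

Lemma continuous_Aop i : continuous (fun x => Aop v x i).
Proof.
apply: continuous_bigsum => j x.
by apply: cvgM; [exact: (@nbhs_filter _ x)|exact: (@cst_continuous _ _ _ x)|exact: (@coord_continuous R)].
Qed.

Lemma continuous_colsum j : continuous (fun x : 'M[R]_(n, m) => \sum_i x i j).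
Proof. by apply: continuous_bigsum => i; exact: (@coord_continuous R). Qed.

Lemma closed_conformal s : closed [set d | conformal s d].
Proof.
rewrite (_ : mkset _ = \bigcap_(p in setT)
    [set d : 'M[R]_(n, m) | match s p return Prop with
      | None => d p.1 p.2 = 0
      | Some b => 0 <= (if b then d p.1 p.2 else - d p.1 p.2) end]); last first.
  apply/seteqP; split => [d sd [i j] _|d sd i j]; first exact: sd.
  exact: (sd (i, j) I).
apply: closed_bigI => -[i j] _ /=.
case: (s _) => [[]|].
- exact/closed_superlevel/(@coord_continuous R).
- apply: closed_superlevel => x.
  by apply: cvgN; [exact: (@nbhs_filter _ x)|exact: (@coord_continuous R)].
- exact/closed_level/(@coord_continuous R).
Qed.

Lemma closed_colsum (c : R) : closed [set d : 'M[R]_(n, m) | forall j, \sum_i d i j = c].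
Proof.
rewrite (_ : mkset _ = \bigcap_(j in setT)
    [set d : 'M[R]_(n, m) | \sum_i d i j = c]); last first.
  by apply/seteqP; split => [d dc j _|d dc j]; [exact: dc|exact: (dc j I)].
by apply: closed_bigI => j _; exact/closed_level/continuous_colsum.
Qed.

Lemma continuous_normR : continuous (fun t : R => `|t|).
Proof. by move=> t; exact: (@norm_continuous R R). Qed.

Lemma conformal_cone_bound s :
  (forall k, conformal s k -> colsum0 k -> norm1_Aop k = 0 -> k = 0) ->
  exists2 K, 0 <= K & forall d, conformal s d -> colsum0 d ->
    norm1_mx d <= K * norm1_Aop d.
Proof.
move=> ker0.
pose S := [set d | conformal s d] `&` [set d | colsum0 d]
  `&` [set d | norm1_mx d = 1].
have scale d : conformal s d -> colsum0 d -> norm1_mx d != 0 ->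
    S ((norm1_mx d)^-1 *: d).
  move=> sd d0 dn0; split; [split|].
  - by apply: conformalZ => //; rewrite invr_ge0 norm1_mx_ge0.
  - exact: colsum0Z.
  - by rewrite /= norm1_mxZ ger0_norm ?mulVf // invr_ge0 norm1_mx_ge0.
(* If the cone misses the unit sphere, it is reduced to [0] and [K = 0] serves. *)
have [[d0 Sd0]|S0] := pselect (S !=set0); last first.
  exists 0 => // d sd d0; rewrite mul0r leNgt; apply/negP => dp.
  by apply: S0; exists ((norm1_mx d)^-1 *: d); apply: scale => //; rewrite gt_eqF.
have Scl : closed S.
  apply: closedI; last first.
    apply/closed_level/(continuous_entry_sum (fun _ _ t => `|t|)) => _ _.
    exact: continuous_normR.
  by apply: closedI; [exact: closed_conformal|exact: closed_colsum].
have cA : continuous norm1_Aop.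
  apply: continuous_bigsum => i x.
  by apply: continuous_comp; [exact: continuous_Aop|exact: continuous_normR].
have Sb x : S x -> forall i j, `|x i j| <= 1.
  by move=> [_ <-] i j; exact: norm1_mx_entry.
have [c [[sc c0] c1] cmin] :=
  bounded_closed_mx_min _ _ _ _ _ _ (ex_intro _ _ Sd0) Scl Sb cA.
have cpos : 0 < norm1_Aop c.
  rewrite lt0r norm1_Aop_ge0 andbT; apply/eqP => Ac0.
  move: c1; rewrite /= (ker0 _ sc c0 Ac0) -(scale0r 0) norm1_mxZ normr0 mul0r.
  by move/eqP; rewrite eq_sym oner_eq0.
(* By homogeneity, the inverse of the minimum on the sphere works on the whole cone. *)
exists (norm1_Aop c)^-1; first by rewrite invr_ge0 ltW.
move=> d sd dc0; have [->|dn0] := eqVneq (norm1_mx d) 0.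
  by rewrite mulr_ge0 ?norm1_Aop_ge0 // invr_ge0 ltW.
have dp : 0 < norm1_mx d by rewrite lt0r dn0 norm1_mx_ge0.
have := cmin _ (scale d sd dc0 dn0).
rewrite norm1_AopZ ger0_norm ?invr_ge0 ?norm1_mx_ge0 //.
by rewrite ler_pdivlMl // ler_pdivlMl // mulrC.
Qed.

(** For [d = y - x], such an [e] puts every entry of [x + e] between those of [x] and [y], so
    nonnegativity survives. *)
Definition shrinks e d := forall i j, 0 <= e i j <= d i j \/ d i j <= e i j <= 0.

(* Subtracting the largest multiple of [k] that keeps the signs of [d] kills an entry. *)
Lemma conformal_reduce d k : conformal (sign_pattern d) k -> k != 0 ->
  exists2 t, shrinks (d - t *: k) d &
    exists p, d p.1 p.2 != 0 /\ (d - t *: k) p.1 p.2 = 0.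
Proof.
move=> dk kn0.
have [p0 kp0] : exists p, k p.1 p.2 != 0.
  apply: contrapT => h; case/eqP: kn0; apply/matrixP => i j; rewrite mxE.
  by apply/eqP; apply/negPn/negP => kij; apply: h; exists (i, j).
pose r (p : 'I_n * 'I_m) := d p.1 p.2 / k p.1 p.2.
(* The least ratio marks the entry that reaches zero first. *)
case: (@arg_minP _ _ _ p0 (fun p => k p.1 p.2 != 0) r kp0) => p kp pmin.
(* Conformity to the pattern of [d] gives a nonzero entry of [k] the sign of the entry of [d], so
   all ratios are positive. *)
have same i j : k i j != 0 -> (0 < d i j /\ 0 < k i j) \/ (d i j < 0 /\ k i j < 0).
  move=> kij; have := dk i j; rewrite ffunE /=; case: eqP => [_ k0|/eqP dij].
    by rewrite k0 eqxx in kij.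
  case: ltP => [dp kp'|dn kp']; [left|right]; split=> //.
  - by rewrite lt0r kij.
  - by rewrite lt_neqAle dij.
  - by rewrite lt_neqAle kij -oppr_ge0.
have rpos i j : k i j != 0 -> 0 < r (i, j).
  move=> /same[] [d0 k0]; first exact: divr_gt0.
  by rewrite /r /= -mulrNN -invrN divr_gt0 // oppr_gt0.
have tp : 0 < r p by case: (p) kp => i j /rpos.
exists (r p).
  move=> i j; rewrite !mxE; have [->|kij] := eqVneq (k i j) 0.
    rewrite mulr0 subr0; case: (lerP 0 (d i j)) => h; first by left; apply/andP; split; lra.
    by right; apply/andP; split; lra.
  have := pmin (i, j) kij; have := rpos i j kij.
  have -> : d i j = r (i, j) * k i j by rewrite /r /= divfK.
  move: tp; set t := r p; set u := r (i, j) => t0 u0 tu.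
  rewrite -mulrBl.
  by case: (same _ _ kij) => -[_ k0]; [left|right]; apply/andP; split; nra.
exists p; split; last by rewrite !mxE /r divfK // subrr.
by case: (same p.1 p.2 kp) => -[d0 _]; [rewrite gt_eqF|rewrite lt_eqF].
Qed.

Lemma shrinks_trans e d f : shrinks e d -> shrinks d f -> shrinks e f.
Proof.
move=> ed df i j; case: (ed i j) => /andP[a b]; case: (df i j) => /andP[a' b'];
  (try by left; apply/andP; split; lra); by right; apply/andP; split; lra.
Qed.

Lemma conformal_bound : exists2 K, 0 <= K & forall d, colsum0 d ->
  exists e, [/\ colsum0 e, forall i, Aop v e i = Aop v d i, shrinks e d &
    norm1_mx e <= K * norm1_Aop d].
Proof.
(* The kernel condition sits inside as a premise, so every pattern gets a constant, [0] where the
   condition fails; the sum of these nonnegative constants dominates each of them. *)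
have /choice[Kf KfP] : forall s, exists K, 0 <= K /\
    ((forall k, conformal s k -> colsum0 k -> norm1_Aop k = 0 -> k = 0) ->
     forall d, conformal s d -> colsum0 d -> norm1_mx d <= K * norm1_Aop d).
  move=> s; have [/conformal_cone_bound[K K0 KP]|nker] := pselect (forall k,
    conformal s k -> colsum0 k -> norm1_Aop k = 0 -> k = 0).
    by exists K; split.
  by exists 0; split => // /nker.
exists (\sum_s Kf s); first by apply: sumr_ge0 => s _; case: (KfP s).
(* Induction on the number of nonzero entries of [d]. *)
move=> d; have [N] := ubnP #|[pred p | d p.1 p.2 != 0]|.
elim: N d => // N IH d dN d0.
have [h|] := pselect (forall k,
    conformal (sign_pattern d) k -> colsum0 k -> norm1_Aop k = 0 -> k = 0).
  exists d; split=> // [i j|].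
    by case: (lerP 0 (d i j)) => ?; [left|right]; apply/andP; split; lra.
  apply: le_trans ((KfP (sign_pattern d)).2 h _ (conformal_sign_pattern d) d0) _.
  apply: ler_wpM2r; first exact: norm1_Aop_ge0.
  rewrite (bigD1 (sign_pattern d)) //= lerDl sumr_ge0 // => s _.
  by case: (KfP s).
move=> nker.
have [k [dk k0 Ak kn0]] : exists k, [/\ conformal (sign_pattern d) k,
    colsum0 k, norm1_Aop k = 0 & k != 0].
  apply: contrapT => h; apply: nker => k dk k0 Ak; apply: contrapT => /eqP kn0.
  by apply: h; exists k.
have Ak0 i : Aop v k i = 0.
  apply/normr0_eq0.
  exact: (psumr_eq0P (fun j _ => normr_ge0 (Aop v k j)) Ak).
have [t sh [p [dp ep]]] := conformal_reduce _ _ dk kn0.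
have AE i : Aop v (d - t *: k) i = Aop v d i by rewrite AopB AopZ Ak0 mulr0 subr0.
have [||e [e0 Ae she eK]] := IH (d - t *: k).
(* Shrinking never revives a zero entry, and the entry [p] has vanished, so the support is strictly
   smaller. *)
- rewrite ltnS in dN; apply: leq_trans dN; apply: proper_card.
  apply/properP; split; last by exists p; rewrite inE ?ep ?eqxx.
  apply/fintype.subsetP => q; rewrite !inE; apply: contra => /eqP dq.
  by apply/eqP; case: (sh q.1 q.2) => /andP[]; rewrite dq => *; lra.
- by apply: colsum0B => //; exact: colsum0Z.
exists e; split => //.
- by move=> i; rewrite Ae AE.
- exact: shrinks_trans she sh.
- by move: eK; rewrite (_ : norm1_Aop (_ - _) = norm1_Aop d) //;
    apply: eq_bigr => i _; rewrite AE.
Qed.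

(** * The Hoffman constant and projections onto fibres of [Aop v] *)

Lemma sum_sqr_le (I : Type) (r : seq I) (f : I -> R) :
  \sum_(i <- r) f i ^+ 2 <= (\sum_(i <- r) `|f i|) ^+ 2.
Proof.
elim: r => [|i r IH]; first by rewrite !big_nil expr0n.
rewrite !big_cons; have := normr_ge0 (f i).
have : 0 <= \sum_(j <- r) `|f j| by exact: sumr_ge0.
by rewrite -[f i ^+ 2]real_normK ?num_real //; nra.
Qed.

Lemma fro_norm_le_norm1 x : fro_norm x <= norm1_mx x.
Proof.
rewrite -[leRHS](ger0_norm (norm1_mx_ge0 x)) -sqrtr_sqr ler_wsqrtr //.
rewrite /norm1_mx !pair_bigA /=.
exact: (sum_sqr_le _ _ (fun p : 'I_n * 'I_m => x p.1 p.2)).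
Qed.

Lemma norm1_le_vec_norm (w : 'I_n -> R) : \sum_i `|w i| <= n%:R * vec_norm w.
Proof.
rewrite -[n in n%:R]card_ord -sum1_card natr_sum mulr_suml.
apply: ler_sum => i _; rewrite mul1r -sqrtr_sqr ler_wsqrtr //.
by rewrite (bigD1 i) //= lerDl sumr_ge0 // => j _; exact: sqr_ge0.
Qed.

Lemma fro_normN x : fro_norm (- x) = fro_norm x.
Proof.
congr Num.sqrt; apply: eq_bigr => i _; apply: eq_bigr => j _.
by rewrite mxE sqrrN.
Qed.

Lemma vec_norm_ge0 (w : 'I_n -> R) : 0 <= vec_norm w.
Proof. exact: sqrtr_ge0. Qed.

Lemma hoffman_ok_exists : exists2 H, 0 < H & hoffman_ok v H.
Proof.
have [K K0 KP] := conformal_bound.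
(* The factor [n%:R] passes from the l1 norm of the residual to its Euclidean norm; [+ 1] ensures
   positivity, as [K] may be [0]. *)
exists (K * n%:R + 1); first by rewrite ltr_wpDl // mulr_ge0.
move=> z [y [[y0 y1] Ay]] x p [x0 x1] [_ pmin].
have [|e [e0 Ae she eK]] := KP (y - x).
  by move=> j; under eq_bigr do rewrite !mxE; rewrite sumrB x1 y1 subrr.
have Xq : (@Xset R n m `&` [set y | Aop v y = z]) (x + e).
  split; [split|].
  - move=> i j; have := x0 i j; have := y0 i j; rewrite !mxE.
    by case: (she i j); rewrite !mxE => /andP[]; lra.
  - by move=> j; under eq_bigr do rewrite mxE; rewrite big_split /= x1 e0 addr0.
  - by apply: funext => i; rewrite AopD Ae AopB -Ay addrC subrK.
apply: le_trans (pmin _ Xq) _.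
rewrite opprD addrA subrr add0r fro_normN.
apply: le_trans (fro_norm_le_norm1 e) _; apply: le_trans eK _.
apply: le_trans (_ : K * (n%:R * vec_norm (fun i => Aop v x i - z i)) <= _).
  apply: ler_wpM2l => //; apply: le_trans (norm1_le_vec_norm _).
  by apply: ler_sum => i _; rewrite AopB -Ay distrC.
by rewrite mulrA ler_wpM2r ?vec_norm_ge0 // lerDl.
Qed.

(** Each quotient of distance by residual bounds all admissible constants from below, hence also
    their infimum. *)
Lemma hoffman_okP : hoffman_ok v (hoffman v).
Proof.
have [H0 H0p H0ok] := hoffman_ok_exists.
move=> z zf x p Xx pp.
(* A zero residual admits no quotient, but any admissible constant then forces distance zero. *)
have [r0|rn0] := eqVneq (vec_norm (fun i => Aop v x i - z i)) 0.
  by have := H0ok z zf x p Xx pp; rewrite r0 !mulr0.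
have rp : 0 < vec_norm (fun i => Aop v x i - z i) by rewrite lt0r rn0 vec_norm_ge0.
rewrite -ler_pdivrMr //; apply: lb_le_inf; first by exists H0.
by move=> H [_ Hok]; rewrite ler_pdivrMr //; exact: Hok.
Qed.

Lemma closed_Xset : closed (@Xset R n m).
Proof.
have -> : @Xset R n m = (\bigcap_(p in setT) [set d | 0 <= d p.1 p.2]) `&`
    [set d | forall j, \sum_i d i j = 1].
  apply/seteqP; split => [d [d0 d1]|d [d0 d1]]; split => //.
    by move=> p _; exact: d0.
  by move=> i j; exact: (d0 (i, j) I).
apply: closedI; last exact: closed_colsum.
by apply: closed_bigI => p _; exact/closed_superlevel/(@coord_continuous R).
Qed.

Lemma closed_Aop_level (z : 'I_n -> R) : closed [set x | Aop v x = z].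
Proof.
rewrite (_ : mkset _ = \bigcap_(i in setT) [set x | Aop v x i = z i]); last first.
  apply/seteqP; split => [x <- //|x xz]; apply: funext => i; exact: (xz i I).
by apply: closed_bigI => i _; exact/closed_level/continuous_Aop.
Qed.

Lemma Xset_le1 x i j : Xset x -> x i j <= 1.
Proof.
by move=> [x0 x1]; rewrite -(x1 j) (bigD1 i) //= lerDl sumr_ge0.
Qed.

Lemma proj_fiber_exists y x : Xset y ->
  exists p, is_proj (@Xset R n m `&` [set q | Aop v q = Aop v y]) x p.
Proof.
move=> Xy; pose S := @Xset R n m `&` [set q | Aop v q = Aop v y].
have S0 : S !=set0 by exists y.
have Scl : closed S by apply: closedI; [exact: closed_Xset|exact: closed_Aop_level].
have Sb q : S q -> forall i j, `|q i j| <= 1.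
  move=> [Xq _] i j; rewrite ger0_norm; first exact: Xset_le1.
  by case: Xq.
have fc : continuous (fun q : 'M[R]_(n, m) => \sum_i \sum_j (x i j - q i j) ^+ 2).
  apply: (continuous_entry_sum (fun i j t => (x i j - t) ^+ 2)) => i j t.
  apply: (@continuous_comp _ _ _ (fun t => x i j - t) (fun t => t ^+ 2)).
    by apply: cvgB; [exact: cvg_cst|exact: cvg_id].
  exact: exprn_continuous.
have [p Sp pmin] := bounded_closed_mx_min _ _ _ _ _ _ S0 Scl Sb fc.
exists p; split => // q /pmin pq; apply: ler_wsqrtr.
under eq_bigr do under eq_bigr do rewrite !mxE.
by under [leRHS]eq_bigr do under eq_bigr do rewrite !mxE.
Qed.

End Hoffman.

(** * Derivative of the scalar penalty and its quadratic bounds *)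

Section ScalarPenalty.
Context {R : realType}.
Implicit Types (a b c s t u w M : R).

Lemma is_derive_cvg (f : R -> R) a d : is_derive a 1 f d ->
  h^-1 *: (f (h *: 1 + a) - f a) @[h --> 0^'] --> d.
Proof. by move=> [fd <-]; exact: fd. Qed.

Lemma cvg_is_derive (f : R -> R) a d :
  h^-1 *: (f (h *: 1 + a) - f a) @[h --> 0^'] --> d -> is_derive a 1 f d.
Proof.
by move=> fd; apply: DeriveDef; [apply: cvgP; exact: fd|apply: cvg_lim].
Qed.

(** Since [f a = g a], each difference quotient of the glued function at [a] is one of [f] or of
    [g], and both tend to [d]. *)
Lemma is_derive_glue (f g : R -> R) a d : f a = g a ->
  is_derive a 1 f d -> is_derive a 1 g d ->
  is_derive a 1 (fun s => if a < s then f s else g s) d.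
Proof.
move=> fga /is_derive_cvg fd /is_derive_cvg gd; apply: cvg_is_derive.
apply/cvgrPdist_lt => e e0.
move/cvgrPdist_lt: fd => /(_ e e0) fd; move/cvgrPdist_lt: gd => /(_ e e0) gd.
near=> h; rewrite ltxx -fga; case: ifP => _.
  by near: h.
by rewrite fga; near: h.
Unshelve. all: by end_near. Qed.

(* [htilde_i v B i] unfolds to [penalty (B i) (ulow v B i)]; [grad_Fobj] and the
   bounds on [Fobj] rely on this conversion. *)
Definition penalty b a s :=
  if a < s then - (b * ln s)
  else b / (2 * a ^+ 2) * (s - a) ^+ 2 - b / a * (s - a) - b * ln a.

Definition penalty_deriv b a s :=
  if a < s then - (b / s) else b / a ^+ 2 * (s - a) - b / a.

Lemma is_derive_penalty b a s : 0 < a ->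
  is_derive s 1 (penalty b a) (penalty_deriv b a s).
Proof.
move=> a0.
have dln t : 0 < t -> is_derive t 1 (fun s => - (b * ln s)) (- (b / t)).
  move=> t0; have dt := is_derive1_ln t0.
  exact: is_deriveN.
have dquad t : is_derive t 1
   (fun s => b / (2 * a ^+ 2) * (s - a) ^+ 2 - b / a * (s - a) - b * ln a)
   (b / a ^+ 2 * (t - a) - b / a).
  apply: is_derive_eq.
  by rewrite /GRing.scale /=; field; rewrite gt_eqF.
rewrite /penalty_deriv; case: (ltgtP a s) => [sa|sa|<-].
- apply: near_eq_is_derive (dln s (lt_trans a0 sa)).
  by near=> t; rewrite /penalty ifT //; near: t; exact: lt_nbhsr.
- apply: near_eq_is_derive (dquad s).
  near=> t; rewrite /penalty ifF //; apply/negbTE; rewrite -leNgt ltW //.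
  by near: t; exact: lt_nbhsl.
- apply: is_derive_glue => //.
  + by rewrite subrr expr0n /= !mulr0 subr0 add0r.
  + by have := dln a a0; rewrite subrr mulr0 add0r.
Unshelve. all: by end_near. Qed.

(** The mean value theorem on either side of [s]. The cap [M] serves strong convexity, as the
    curvature of the logarithm decays to the right. *)
Lemma convex_tangent (f df : R -> R) M :
  (forall s, is_derive s 1 f (df s)) ->
  (forall u w, u <= w -> w <= M -> df u <= df w) ->
  forall s t, s <= M -> t <= M -> f s + df s * (t - s) <= f t.
Proof.
move=> fd mono s t sM tM.
have fc u w : {within `[u, w], continuous f}.
  apply: derivable_within_continuous => z _; exact: (@ex_derive _ _ _ _ _ _ _ (fd z)).
have [st|/ltW ts] := leP s t.
  have [c + fE] := MVT_segment st (fun z _ => fd z) (fc _ _).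
  rewrite in_itv /= => /andP[sc ct].
  have := mono s c sc (le_trans ct tM); nra.
have [c + fE] := MVT_segment ts (fun z _ => fd z) (fc _ _).
rewrite in_itv /= => /andP[tc cs].
have := mono c s cs sM; nra.
Qed.

Lemma inv_diff_le p u w : 0 < p -> p <= u -> u <= w ->
  u^-1 - w^-1 <= (p ^+ 2)^-1 * (w - u).
Proof.
move=> p0 pu uw; have u0 := lt_le_trans p0 pu; have w0 := lt_le_trans u0 uw.
have -> : u^-1 - w^-1 = (u * w)^-1 * (w - u).
  by field; rewrite !gt_eqF.
apply: ler_wpM2r; first by rewrite subr_ge0.
by rewrite lef_pV2 ?posrE ?mulr_gt0 ?exprn_gt0 //; nra.
Qed.

Lemma inv_diff_ge M u w : 0 < u -> u <= w -> w <= M ->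
  (M ^+ 2)^-1 * (w - u) <= u^-1 - w^-1.
Proof.
move=> u0 uw wM; have w0 := lt_le_trans u0 uw; have M0 := lt_le_trans w0 wM.
have -> : u^-1 - w^-1 = (u * w)^-1 * (w - u).
  by field; rewrite !gt_eqF.
apply: ler_wpM2r; first by rewrite subr_ge0.
by rewrite lef_pV2 ?posrE ?mulr_gt0 ?exprn_gt0 //; nra.
Qed.

(** The derivative grows at rate [b / a ^+ 2] on the quadratic branch and at least [b / M ^+ 2] on
    the logarithmic one. If [u] and [w] lie on different sides of [a], the two estimates add up,
    both branches being [- (b / a)] there. *)
Lemma penalty_deriv_diff_ge b a M c u w : 0 < b -> 0 < a -> a <= M ->
  c <= b / M ^+ 2 -> u <= w -> w <= M ->
  c * (w - u) <= penalty_deriv b a w - penalty_deriv b a u.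
Proof.
move=> b0 a0 aM cb uw wM.
have ca : c <= b / a ^+ 2.
  apply: (le_trans cb); apply: ler_wpM2l; first exact: ltW.
  by rewrite lef_pV2 ?posrE ?exprn_gt0 ?(lt_le_trans a0 aM) //; nra.
rewrite /penalty_deriv; case: (ltP a u) => [au|ua].
  rewrite (lt_le_trans au uw).
  have := inv_diff_ge M u w (lt_trans a0 au) uw wM; nra.
case: (ltP a w) => [aw|wa]; last by nra.
have := inv_diff_ge M a w a0 (ltW aw) wM; nra.
Qed.

Lemma penalty_deriv_diff_le b a u w : 0 < b -> 0 < a -> u <= w ->
  penalty_deriv b a w - penalty_deriv b a u <= b / a ^+ 2 * (w - u).
Proof.
move=> b0 a0 uw; rewrite /penalty_deriv; case: (ltP a u) => [au|ua].
  rewrite (lt_le_trans au uw).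
  have := inv_diff_le a u w a0 (ltW au) uw; nra.
case: (ltP a w) => [aw|wa]; last by nra.
have := inv_diff_le a a w a0 (lexx a) (ltW aw); nra.
Qed.

Lemma penalty_strongly_convex b a M c s t : 0 < b -> 0 < a -> a <= M ->
  c <= b / M ^+ 2 -> s <= M -> t <= M ->
  penalty b a s + penalty_deriv b a s * (t - s) + c / 2 * (t - s) ^+ 2
    <= penalty b a t.
Proof.
move=> b0 a0 aM cb sM tM.
have fd (r : R) : is_derive r 1 (fun z => penalty b a z - c / 2 * z ^+ 2)
    (penalty_deriv b a r - c * r).
  have dp := is_derive_penalty b a r a0; apply: is_derive_eq.
  by rewrite /GRing.scale /=; field.
have mono u w : u <= w -> w <= M ->
    penalty_deriv b a u - c * u <= penalty_deriv b a w - c * w.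
  by move=> uw wM; have := penalty_deriv_diff_ge b a M c u w b0 a0 aM cb uw wM; nra.
have /= := convex_tangent _ _ M fd mono s t sM tM; nra.
Qed.

Lemma penalty_smooth b a c s t : 0 < b -> 0 < a -> b / a ^+ 2 <= c ->
  penalty b a t <=
    penalty b a s + penalty_deriv b a s * (t - s) + c / 2 * (t - s) ^+ 2.
Proof.
move=> b0 a0 cb.
have fd (r : R) : is_derive r 1 (fun z => c / 2 * z ^+ 2 - penalty b a z)
    (c * r - penalty_deriv b a r).
  have dp := is_derive_penalty b a r a0; apply: is_derive_eq.
  by rewrite /GRing.scale /=; field.
(* Monotonicity holds on the whole line, so the cap only has to cover [s] and [t]. *)
have mono u w : u <= w -> w <= Num.max s t ->
    c * u - penalty_deriv b a u <= c * w - penalty_deriv b a w.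
  by move=> uw _; have := penalty_deriv_diff_le b a u w b0 a0 uw; nra.
have sM : s <= Num.max s t by rewrite le_max lexx.
have tM : t <= Num.max s t by rewrite le_max lexx orbT.
have /= := convex_tangent _ _ (Num.max s t) fd mono s t sM tM; nra.
Qed.
End ScalarPenalty.

(** * Gradient of the objective and its quadratic bounds *)

Section Objective.
Context {R : realType} {n m : nat}.
Variables (v : 'M[R]_(n, m)) (B : 'I_n -> R).
Implicit Types (x y d : 'M[R]_(n, m)).

Definition Fslope x i := penalty_deriv (B i) (ulow v B i) (Aop v x i).

(** Moving the entry [(i, j)] changes only coordinate [i] of [Aop v x]; the other penalties form the
    constant [C]. *)
Lemma grad_Fobj x i j : 0 < ulow v B i ->
  grad (Fobj v B) x i j = Fslope x i * v i j.
Proof.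
move=> a0; rewrite mxE derive1E.
pose C := \sum_(k | k != i) htilde_i v B k (Aop v x k).
have Ad k s : Aop v (x + s *: delta_mx i j) k = Aop v x k + s * (v i j *+ (k == i)).
  rewrite AopD AopZ /Aop; congr (_ + s * _).
  rewrite (bigD1 j) //= big1 ?addr0 => [|l lj].
    by rewrite mxE eqxx andbT; case: eqP => [->|_]; rewrite ?mulr1 ?mulr0 ?mulr0n.
  by rewrite mxE (negbTE lj) andbF mulr0.
have -> : (fun s => Fobj v B (x + s *: delta_mx i j)) =
    (fun s => penalty (B i) (ulow v B i) (Aop v x i + s * v i j) + C).
  apply: funext => s; rewrite /Fobj /htilde (bigD1 i) //= Ad eqxx mulr1n.
  congr (_ + _); apply: eq_bigr => k ki.
  by rewrite Ad (negbTE ki) mulr0n mulr0 addr0.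
have dlin : is_derive (0 : R) 1 (fun s => Aop v x i + s * v i j) (v i j).
  by apply: is_derive_eq; rewrite /GRing.scale /=; ring.
have dp := is_derive_penalty (B i) _ (Aop v x i + 0 * v i j) a0.
have dc := @is_derive1_comp _ _ (fun s => Aop v x i + s * v i j) _ _ _ dp dlin.
have dpC := is_deriveD dc (is_derive_cst C (0 : R) 1).
by rewrite (@derive_val _ _ _ _ _ _ _ dpC) addr0 mul0r addr0.
Qed.

Definition dot d x : R := \sum_i \sum_j d i j * x i j.
Definition sqn x : R := \sum_i \sum_j x i j ^+ 2.

Lemma sqn_ge0 x : 0 <= sqn x.
Proof. by apply: sumr_ge0 => i _; apply: sumr_ge0 => j _; exact: sqr_ge0. Qed.

Lemma fro_norm_le_sqn x y : fro_norm x <= fro_norm y -> sqn x <= sqn y.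
Proof. by rewrite ler_psqrt // nnegrE sqn_ge0. Qed.

Lemma sqn_fro_norm x : sqn x = fro_norm x ^+ 2.
Proof. by rewrite sqr_sqrtr // sqn_ge0. Qed.

(** The last term is independent of [y], so it cancels when two candidates for a projection are
    compared. *)
Lemma sqnBZ (c : R) x y d :
  sqn (x - c *: d - y) = sqn (y - x) + 2 * c * dot d (y - x) + c ^+ 2 * sqn d.
Proof.
rewrite /sqn /dot !mulr_sumr -!big_split; apply: eq_bigr => i _ /=.
rewrite !mulr_sumr -!big_split; apply: eq_bigr => j _ /=.
by rewrite !mxE; ring.
Qed.

Lemma sqnZ (c : R) x : sqn (c *: x) = c ^+ 2 * sqn x.
Proof.
rewrite /sqn mulr_sumr; apply: eq_bigr => i _.
by rewrite mulr_sumr; apply: eq_bigr => j _; rewrite mxE exprMn.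
Qed.

Lemma sum_cauchy_schwarz (I : Type) (r : seq I) (f g : I -> R) :
  (\sum_(i <- r) f i * g i) ^+ 2 <=
    (\sum_(i <- r) f i ^+ 2) * (\sum_(i <- r) g i ^+ 2).
Proof.
have cs (p : R) : 0 <= \sum_(i <- r) f i ^+ 2 + 2 * p * (\sum_(i <- r) f i * g i)
    + p ^+ 2 * (\sum_(i <- r) g i ^+ 2).
  rewrite !mulr_sumr -!big_split /= sumr_ge0 // => i _.
  by rewrite (_ : _ + _ = (f i + p * g i) ^+ 2) ?sqr_ge0 //; ring.
set S := \sum_(i <- r) f i * g i in cs *.
set F := \sum_(i <- r) f i ^+ 2 in cs *; set G := \sum_(i <- r) g i ^+ 2 in cs *.
have G0 : 0 <= G by apply: sumr_ge0 => i _; exact: sqr_ge0.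
have F0 : 0 <= F by apply: sumr_ge0 => i _; exact: sqr_ge0.
have [Gz|Gn] := eqVneq G 0.
  have [->|Sn] := eqVneq S 0; first by rewrite expr0n /= mulr_ge0.
  (* With [G = 0] the form is affine in [p], and this [p] gives it the negative value [- F - 2]. *)
  have := cs (- (F + 1) / S).
  rewrite Gz !mulr0 addr0 (_ : 2 * _ * _ = - 2 * (F + 1)); last by field.
  lra.
have Gp : 0 < G by rewrite lt0r Gn.
(* The minimiser of the quadratic in [p]. *)
have := cs (- S / G).
rewrite (_ : F + _ + _ = (F * G - S ^+ 2) / G); last by field.
by rewrite pmulr_lge0 ?invr_gt0 // subr_ge0.
Qed.

Lemma normA_ge i : Num.sqrt (\sum_j v i j ^+ 2) <= normA v.
Proof. exact: le_bigmax. Qed.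

Lemma Aop_sqr_le d : \sum_i Aop v d i ^+ 2 <= normA v ^+ 2 * sqn d.
Proof.
rewrite mulr_sumr; apply: ler_sum => i _.
apply: le_trans (sum_cauchy_schwarz _ _ _ _) _.
apply: ler_wpM2r; first by apply: sumr_ge0 => j _; exact: sqr_ge0.
have v0 : 0 <= \sum_j v i j ^+ 2 by apply: sumr_ge0 => j _; exact: sqr_ge0.
have := normA_ge i; have := sqrtr_ge0 (\sum_j v i j ^+ 2).
by rewrite -{3}(sqr_sqrtr v0); nra.
Qed.

Hypotheses (v0 : nonneg_mx v) (vnd : nondegen_mx v) (B0 : forall i, 0 < B i).

Lemma norm1_row_gt0 i : 0 < norm1_row v i.
Proof.
have [j vij] := vnd.1 i; rewrite /norm1_row (bigD1 j) //=.
by rewrite ltr_wpDr ?normr_gt0 // sumr_ge0.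
Qed.

Lemma norm1_ge i : B i <= norm1 B.
Proof.
rewrite /norm1 (bigD1 i) //= -[leLHS]addr0 lerD ?ler_norm //.
exact: sumr_ge0.
Qed.

Lemma norm1_gt0 (i : 'I_n) : 0 < norm1 B.
Proof. exact: lt_le_trans (B0 i) (norm1_ge i). Qed.

Lemma ulow_gt0 i : 0 < ulow v B i.
Proof. by rewrite divr_gt0 ?mulr_gt0 ?norm1_row_gt0 ?(norm1_gt0 i). Qed.

(** Places the junction of the two branches below the cap used for strong convexity. *)
Lemma ulow_le i : ulow v B i <= norm1_row v i.
Proof.
rewrite ler_pdivrMr ?(norm1_gt0 i) // mulrC.
by rewrite ler_wpM2l ?norm1_ge // ltW ?norm1_row_gt0.
Qed.

Lemma Aop_le x i : Xset x -> Aop v x i <= norm1_row v i.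
Proof.
move=> Xx; apply: ler_sum => j _; rewrite ger0_norm //.
by rewrite ler_piMr // Xset_le1.
Qed.

Lemma mu_c_le i : mu_c v B <= B i / norm1_row v i ^+ 2.
Proof. exact: bigmin_le. Qed.

Lemma L_c_ge i : B i / ulow v B i ^+ 2 <= L_c v B.
Proof. exact: le_bigmax. Qed.

Lemma dot_grad x d : dot (grad (Fobj v B) x) d = \sum_i Fslope x i * Aop v d i.
Proof.
apply: eq_bigr => i _; rewrite /Aop mulr_sumr; apply: eq_bigr => j _.
by rewrite grad_Fobj ?ulow_gt0 // mulrA.
Qed.

Lemma Fobj_smooth x y : Fobj v B y <= Fobj v B x
  + dot (grad (Fobj v B) x) (y - x) + L_c v B * normA v ^+ 2 / 2 * sqn (y - x).
Proof.
have L0 : 0 <= L_c v B by exact: bigmax_ge_id.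
have h : Fobj v B y <= Fobj v B x + dot (grad (Fobj v B) x) (y - x)
    + L_c v B / 2 * \sum_i Aop v (y - x) i ^+ 2.
  rewrite dot_grad mulr_sumr -!big_split /=; apply: ler_sum => i _.
  by rewrite AopB; apply: penalty_smooth; rewrite ?ulow_gt0 ?L_c_ge.
have := Aop_sqr_le (y - x); nra.
Qed.

(** On [Xset] the coordinates of [Aop v x] stay below [norm1_row v i], the cap that yields the
    modulus [mu_c]. Curvature is measured through [Aop v] only; the Hoffman bound later converts it
    to distances in [x]. *)
Lemma Fobj_strongly_convex x y : Xset x -> Xset y ->
  Fobj v B x + dot (grad (Fobj v B) x) (y - x)
    + mu_c v B / 2 * \sum_i Aop v (y - x) i ^+ 2 <= Fobj v B y.
Proof.
move=> Xx Xy; rewrite dot_grad mulr_sumr -!big_split /=; apply: ler_sum => i _.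
rewrite AopB; apply: (@penalty_strongly_convex _ _ _ (norm1_row v i)).
- exact: B0.
- exact: ulow_gt0.
- exact: ulow_le.
- exact: mu_c_le.
- exact: Aop_le.
- exact: Aop_le.
Qed.

(** * Decrease of the objective in one projected gradient step *)

Lemma Xset_segment (c : R) x y : 0 <= c -> c <= 1 -> Xset x -> Xset y ->
  Xset (x + c *: (y - x)).
Proof.
move=> c0 c1 [x0 x1] [y0 y1]; split => [i j|j].
  by rewrite !mxE; have := x0 i j; have := y0 i j; nra.
under eq_bigr do rewrite !mxE.
by rewrite big_split /= -mulr_sumr sumrB x1 y1 subrr mulr0 addr0.
Qed.

(** Completing the square turns the nearest-point property into minimality for the quadratic model
    of curvature [l]. *)
Lemma proj_step_le (l : R) x x' y : 0 < l ->
  is_proj (@Xset R n m) (x - l^-1 *: grad (Fobj v B) x) x' -> Xset y ->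
  dot (grad (Fobj v B) x) (x' - x) + l / 2 * sqn (x' - x) <=
  dot (grad (Fobj v B) x) (y - x) + l / 2 * sqn (y - x).
Proof.
move=> l0 [_ pmin] Xy; have /fro_norm_le_sqn := pmin y Xy.
rewrite !sqnBZ lerD2r => h.
have := ler_wpM2l (ltW (divr_gt0 l0 (ltr0Sn R 1))) h.
rewrite !mulrDr.
have e q : l / 2 * (2 * l^-1 * q) = q by field; rewrite gt_eqF.
by rewrite !e => ?; lra.
Qed.

Lemma dotZ (c : R) d x : dot d (c *: x) = c * dot d x.
Proof.
rewrite /dot mulr_sumr; apply: eq_bigr => i _.
by rewrite mulr_sumr; apply: eq_bigr => j _; rewrite mxE mulrCA.
Qed.

(* The test point is [x + c (q - x)], where [q] is the projection of [x] onto
   the fibre of [A] through [y]; the Hoffman bound on [|x - q|] makes the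
   quadratic terms cancel as soon as [c L H^2 |A|^2 <= mu]. *)
Lemma Fobj_contraction (c : R) x x' y :
  0 < L_c v B * normA v ^+ 2 -> 0 <= c -> c <= 1 ->
  c * (L_c v B * hoffman v ^+ 2 * normA v ^+ 2) <= mu_c v B ->
  Xset x -> Xset y ->
  is_proj (@Xset R n m)
    (x - (L_c v B * normA v ^+ 2)^-1 *: grad (Fobj v B) x) x' ->
  Fobj v B x' - Fobj v B y <= (1 - c) * (Fobj v B x - Fobj v B y).
Proof.
move=> l0 c0 c1 cmu Xx Xy px'.
have [q pq] := proj_fiber_exists v y x Xy; have [[Xq Aq] _] := pq.
have Fq : Fobj v B q = Fobj v B y by rewrite /Fobj Aq.
have hof : sqn (q - x) <= hoffman v ^+ 2 * \sum_i Aop v (q - x) i ^+ 2.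
  have AE : vec_norm (fun i => Aop v x i - Aop v y i) =
      vec_norm (Aop v (q - x)).
    by congr Num.sqrt; apply: eq_bigr => i _; rewrite AopB Aq -sqrrN opprB.
  have S0 : 0 <= \sum_i Aop v (q - x) i ^+ 2.
    by apply: sumr_ge0 => i _; exact: sqr_ge0.
  have := hoffman_okP v _ (ex_intro _ y (conj Xy erefl)) x q Xx pq.
  rewrite -fro_normN opprB AE sqn_fro_norm -(sqr_sqrtr S0) -exprMn => h.
  by rewrite ler_sqr ?nnegrE ?(le_trans (sqrtr_ge0 _) h) ?sqrtr_ge0.
have sm := Fobj_smooth x x'.
have st := proj_step_le _ _ _ _ l0 px' (Xset_segment c x q c0 c1 Xx Xq).
have sc := Fobj_strongly_convex x q Xx Xq.
rewrite [x + _]addrC addrK dotZ sqnZ in st.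
move: sm st sc hof cmu; rewrite Fq.
have : 0 <= \sum_i Aop v (q - x) i ^+ 2.
  by apply: sumr_ge0 => i _; exact: sqr_ge0.
move: l0.
set l := L_c v B * normA v ^+ 2; set G := dot _ (q - x).
set Q := \sum_i _; set N := sqn (q - x).
rewrite (mulrAC _ (hoffman v ^+ 2)) -/l => l0 Q0 sm st sc hof cmu.
have q1 : c ^+ 2 * (l * N) <= c * (mu_c v B * Q).
  rewrite expr2 -mulrA; apply: ler_wpM2l => //.
  apply: le_trans (_ : c * (l * (hoffman v ^+ 2 * Q)) <= _).
    by apply: ler_wpM2l => //; apply: ler_wpM2l => //; exact: ltW.
  rewrite (_ : c * _ = c * (l * hoffman v ^+ 2) * Q); last by ring.
  exact: ler_wpM2r.
(* Chained: smoothness, minimality against the test point, [q1] for its quadratic term, then [c]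
   times strong convexity. *)
have := ler_wpM2l c0 sc.
lra.
Qed.
Lemma mu_c_gt0 (i : 'I_n) : 0 < mu_c v B.
Proof.
have p k : 0 < B k / norm1_row v k ^+ 2.
  by rewrite divr_gt0 ?exprn_gt0 ?norm1_row_gt0.
(* The default value of the minimum is the maximum of the same quotients, positive once an index [i]
   exists. *)
apply: lt_bigmin => [|k _]; last exact: p.
by apply: lt_le_trans (p i) _; exact: (@le_bigmax _ _ _ 0).
Qed.

Lemma L_c_gt0 (i : 'I_n) : 0 < L_c v B.
Proof.
by apply: lt_le_trans (L_c_ge i); rewrite divr_gt0 ?exprn_gt0 ?ulow_gt0.
Qed.

Lemma normA_gt0 (i : 'I_n) : 0 < normA v.
Proof.
apply: lt_le_trans (normA_ge i); have [j vij] := vnd.1 i.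
rewrite sqrtr_gt0 (bigD1 j) //= ltr_wpDr ?exprn_even_gt0 ?vij //.
by apply: sumr_ge0 => k _; exact: sqr_ge0.
Qed.

Lemma Fstar_contraction (i : 'I_n) (c : R) x x' : 0 < c -> c <= 1 ->
  c * (L_c v B * hoffman v ^+ 2 * normA v ^+ 2) <= mu_c v B ->
  Xset x ->
  is_proj (@Xset R n m)
    (x - (L_c v B * normA v ^+ 2)^-1 *: grad (Fobj v B) x) x' ->
  Fobj v B x' - Fstar v B <= (1 - c) * (Fobj v B x - Fstar v B).
Proof.
move=> c0 c1 cmu Xx px'.
have l0 : 0 < L_c v B * normA v ^+ 2.
  by rewrite mulr_gt0 ?(L_c_gt0 i) // exprn_gt0 // (normA_gt0 i).
(* Solved for [Fobj v B y], the contraction is a lower bound uniform in [y], so it passes to the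
   infimum. *)
have : c^-1 * (Fobj v B x' - (1 - c) * Fobj v B x) <= Fstar v B.
  apply: lb_le_inf; first by exists (Fobj v B x), x.
  move=> _ [y Xy <-]; rewrite ler_pdivrMl //.
  have := Fobj_contraction c x x' y l0 (ltW c0) c1 cmu Xx Xy px'; lra.
by rewrite ler_pdivrMl //; lra.
Qed.
End Objective.

(** * The linear rate, by induction on the number of steps *)

Theorem theorem5 (R : realType) (n m : nat) (v : 'M[R]_(n, m)) (B : 'I_n -> R)
  (x : nat -> 'M[R]_(n, m)) :
  nonneg_mx v -> nondegen_mx v -> (forall i, 0 < B i) ->
  Xset (x 0%N) ->
  (forall t : nat,
     is_proj (@Xset R n m)
       (x t - (L_c v B * normA v ^+ 2)^-1 *: grad (Fobj v B) (x t))
       (x t.+1)) ->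
  forall t : nat,
    Fobj v B (x t) - Fstar v B <=
      (1 - mu_c v B /
             Num.max (mu_c v B) (L_c v B * hoffman v ^+ 2 * normA v ^+ 2)) ^+ t
      * (Fobj v B (x 0%N) - Fstar v B).
Proof.
move=> v0 vnd B0 Xx0 px t.
case: n v B x v0 vnd B0 Xx0 px => [|n'] v B x v0 vnd B0 Xx0 px.
  (* Without rows, [mu_c] is its default [0], the factor is [1], and [Fobj] is an empty sum at every
     point. *)
  by rewrite /mu_c !big_ord0 mul0r subr0 expr1n mul1r /Fobj /htilde !big_ord0.
have mu0 := mu_c_gt0 v B vnd B0 ord0.
set P := L_c v B * _ * _; set c := _ / _.
have max0 : 0 < Num.max (mu_c v B) P by rewrite lt_max mu0.
have c0 : 0 < c by rewrite divr_gt0.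
have c1 : c <= 1 by rewrite ler_pdivrMr // mul1r le_max lexx.
have cP : c * P <= mu_c v B.
  by rewrite mulrAC ler_pdivrMr // ler_wpM2l ?(ltW mu0) // le_max lexx orbT.
have Xx s : Xset (x s) by case: s => // s; case: (px s).
elim: t => [|t IH]; first by rewrite expr0 mul1r.
apply: le_trans (Fstar_contraction v B v0 vnd B0 ord0 c _ _ c0 c1 cP (Xx t) (px t)) _.
by rewrite exprS -mulrA ler_wpM2l // subr_ge0.
Qed.
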